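(* Let $q=p$ be a prime, let $1\le\ell\le q-1$, and let $Y=\mathbb{F}_q[x_1,\dots,x_\ell,\theta]$, on which $S_\ell$ acts by $\sigma(x_i)=x_{\sigma(i)}$, $\sigma(\theta)=\theta$ (extended to ring automorphisms). For each multiset $\nu=\{\nu_1,\dots,\nu_\ell\}$ of nonnegative integers set \[ P(\nu)=\prod_{i=1}^\ell\prod_{j=0}^{\nu_i-1}\bigl(x_i-\theta^{q^j}\bigr),\qquad b_{q^\nu}=\frac{1}{\ell!}\sum_{\sigma\in S_\ell}\sigma(P(\nu)), \] where $q^\nu=q^{\nu_1}+\dots+q^{\nu_\ell}$. Then $b_\ell=1$ (the term for $\nu=\{0,\dots,0\}$), and for every multiset $\nu$ of $\ell$ nonnegative integers, \[ b_{q^\nu}\prod_{i=1}^\ell x_i=\sum_{I\subset\{1,\dots,\ell\}}b_{q^{\nu^+(I)}}\prod_{j\in I^c}\theta^{q^{\nu_j}}. \]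
   Context: For $I\subset\{1,\dots,\ell\}$ with complement $I^c$, $\nu^+(I)$ denotes the multiset $\{1+\nu_i:i\in I\}\cup\{\nu_j:j\in I^c\}$. The expression $P(\nu)$ is well defined after choosing an ordering of the entries of $\nu$; $b_{q^\nu}$ does not depend on that choice. *)

(* Defs.v *)
From HB Require Import structures.
From mathcomp Require Import all_boot all_order all_algebra all_fingroup.
From mathcomp Require Import mpoly.

Set Implicit Arguments.
Unset Strict Implicit.
Unset Printing Implicit Defensive.

Import GRing.Theory.
Local Open Scope ring_scope.

(* F_q[x_1, ..., x_l, theta] for q prime: of the l.+1 variables, theta is the
   last one. *)
Notation Y q l := {mpoly 'F_q[l.+1]}.

Section Definitions.

Variables q l : nat.

Definition x (i : 'I_l) : Y q l := 'X_(lift ord_max i).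
Definition theta : Y q l := 'X_ord_max.

(* msym renames variables; lift_perm extends s : 'S_l to the l.+1 variables,
   fixing the last one. *)
Definition act (s : 'S_l) (f : Y q l) : Y q l :=
  msym (lift_perm ord_max ord_max s) f.

(* A multiset of l nonnegative integers is given by an enumeration
   nu : 'I_l -> nat of its entries. *)
Definition qpow (nu : 'I_l -> nat) : nat := (\sum_(i < l) q ^ nu i)%N.

Definition P (nu : 'I_l -> nat) : Y q l :=
  \prod_(i < l) \prod_(j < nu i) (x i - theta ^+ (q ^ j)).

Definition symP (nu : 'I_l -> nat) : Y q l :=
  (l`!%:R : 'F_q)^-1 *: \sum_(s : 'S_l) act s (P nu).

(* b n is symP nu for any nu with qpow nu = n, by lemma b_qpow below; such a nu
   has entries < n.+1, hence the finite search. The value for the n that are not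
   of the form qpow nu is irrelevant. *)
Definition b (n : nat) : Y q l :=
  if [pick nu : {ffun 'I_l -> 'I_n.+1} | qpow (fun i => nu i) == n] is Some nu
  then symP (fun i => nu i) else 0.

Definition nuplus (nu : 'I_l -> nat) (I : {set 'I_l}) (i : 'I_l) : nat :=
  if i \in I then (1 + nu i)%N else nu i.

End Definitions.

Arguments x {q l} i.
Arguments theta {q l}.
Arguments b q l n : clear implicits.

Section WellDefined.

Variables q l : nat.
Implicit Types (s : 'S_l) (nu mu : 'I_l -> nat).

Lemma act_mon s : monoid_morphism (@act q l s).
Proof. by split; [exact: msym1 | exact: msymM]. Qed.

Lemma act_x s i : act s (x i : Y q l) = x (s i).
Proof. by rewrite /act /msym /x mmapX mmap1U lift_perm_lift. Qed.

Lemma act_theta s : act s (theta : Y q l) = theta.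
Proof. by rewrite /act /msym /theta mmapX mmap1U lift_perm_id. Qed.

Lemma act_P s nu :
  act s (P q nu) = \prod_(i < l) \prod_(j < nu i) (x (s i) - theta ^+ (q ^ j)).
Proof.
rewrite {1}/act /P rmorph_prod; apply: eq_bigr => i _.
rewrite rmorph_prod; apply: eq_bigr => j _.
rewrite rmorphB rmorphXn; congr (_ - _ ^+ _); [exact: act_x|exact: act_theta].
Qed.

Lemma eq_symP nu mu : nu =1 mu -> symP q nu = symP q mu.
Proof.
move=> e; rewrite /symP; suff -> : P q nu = P q mu by [].
by apply: eq_bigr => i _; rewrite e.
Qed.

Lemma symP_perm nu s : symP q (nu \o s) = symP q nu.
Proof.
suff E : \sum_(t : 'S_l) act t (P q (nu \o s)) = \sum_(t : 'S_l) act t (P q nu).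
  pose F (f : Y q l) : Y q l := (l`!%:R : 'F_q)^-1 *: f.
  by refine (f_equal F E).
rewrite [RHS](reindex_inj (mulgI s^-1%g)); apply: eq_bigr => t _.
rewrite !act_P [RHS](reindex_inj (@perm_inj _ s)); apply: eq_bigr => i _.
by apply: eq_bigr => j _; rewrite permM permK.
Qed.

Lemma perm_eq_digits (u v : seq nat) : (size u < q)%N -> (size v < q)%N ->
  (\sum_(k <- u) q ^ k = \sum_(k <- v) q ^ k)%N -> perm_eq u v.
Proof.
move=> su sv e; apply/allP => /= k _; apply/eqP.
have q0 : (0 < q)%N by apply: leq_trans su.
pose sh w := [seq j.-1 | j <- w & j != 0%N].
have dec (w : seq nat) :
    (\sum_(j <- w) q ^ j = count_mem 0 w + (\sum_(j <- sh w) q ^ j) * q)%N.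
  elim: w => [|[|j] w IH]; rewrite ?big_nil //= big_cons /= IH.
    by rewrite expn0 addnA.
  by rewrite /sh /= big_cons mulnDl expnSr addnCA.
have szs w : (size (sh w) <= size w)%N by rewrite size_map size_filter count_size.
have cs w j : count_mem j.+1 w = count_mem j (sh w).
  by elim: w => [|[|i] w IH] //=; rewrite IH.
have c0 (w : seq nat) : (size w < q)%N ->
    ((\sum_(j <- w) q ^ j) %% q = count_mem 0 w)%N.
  move=> sw; rewrite dec addnC modnMDl modn_small //.
  exact: leq_ltn_trans (count_size _ _) sw.
elim: k u v su sv e => [|k IH] u v su sv e; first by rewrite -!c0 // e.
have {}c0 : count_mem 0 u = count_mem 0 v by rewrite -!c0 // e.
move: e; rewrite (dec u) (dec v) => e.
rewrite !cs; apply: IH; rewrite ?(leq_ltn_trans (szs _)) //.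
by move/eqP: e; rewrite c0 eqn_add2l eqn_pmul2r // => /eqP.
Qed.

Lemma qpow0 : qpow q (fun _ : 'I_l => 0%N) = l.
Proof. by rewrite /qpow sum_nat_const card_ord muln1. Qed.

Lemma qpow_symP nu mu : (l < q)%N -> qpow q nu = qpow q mu ->
  symP q nu = symP q mu.
Proof.
move=> lq e; set tn := [tuple nu i | i < l]; set tm := [tuple mu i | i < l].
have /tuple_permP[s es] : perm_eq tn tm.
  apply: perm_eq_digits; rewrite ?size_tuple //.
  by rewrite !big_tuple /= /qpow in e *; under eq_bigr do rewrite tnth_mktuple;
     rewrite e; apply: eq_bigr => i _; rewrite tnth_mktuple.
rewrite -(symP_perm mu s); apply: eq_symP => i /=.
have /val_inj E : val tn = val [tuple tnth tm (s i) | i < l] by [].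
by have := congr1 (fun t : l.-tuple nat => tnth t i) E; rewrite !tnth_mktuple.
Qed.

Lemma b_qpow nu : prime q -> (l <= q.-1)%N -> b q l (qpow q nu) = symP q nu.
Proof.
move=> pq lq; rewrite /b; case: pickP => [mu /eqP e | /= no].
  by apply: qpow_symP => //; case: q pq lq.
have bd i : (nu i < (qpow q nu).+1)%N.
  rewrite ltnS /qpow (bigD1 i) //=; apply: leq_trans (leq_addr _ _).
  by apply: ltnW; apply: ltn_expl; apply: prime_gt1.
have /eqP[] := no [ffun i => Ordinal (bd i)].
by rewrite /qpow; apply: eq_bigr => i _; rewrite ffunE.
Qed.

End WellDefined.

(* Main.v *)
(* Writing x_(s i) = (x_(s i) - theta^(q^nu_i)) + theta^(q^nu_i) and expanding
   the product over i, each s (P nu) already satisfies the recursion: the first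
   summand raises nu_i by one. *)

Require Import Defs.
From HB Require Import structures.
From mathcomp Require Import all_boot all_order all_algebra all_fingroup.
From mathcomp Require Import mpoly.

Set Implicit Arguments.
Unset Strict Implicit.
Unset Printing Implicit Defensive.

Import GRing.Theory.
Local Open Scope ring_scope.

(** The recursion already holds for each [act s (P q nu)]. The product of all [x i] is symmetric, so
    its factors can be listed as [x (s i)] and expanded around the powers of [theta]
    ([prod_sub_pow_mul_prod]). These powers do not depend on [s], so averaging is linear and keeps
    the identity ([symP_mul_prod_x]). As [l < q], base-[q] digits recover the multiset, so [b_qpow]
    turns [symP] into [b]. *)

Lemma factorial_Fp_neq0 (q l : nat) : prime q -> (l < q)%N ->
  l`!%:R != 0 :> 'F_q.
Proof.
move=> pq; elim: l => [|l IH] lq; first exact: oner_neq0.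
rewrite factS natrM mulf_neq0 ?IH ?(ltnW lq) //.
by rewrite -(dvdn_pcharf (pchar_Fp pq)) gtnNdvd.
Qed.

Lemma symP0 (q l : nat) : prime q -> (l < q)%N ->
  symP q (fun _ : 'I_l => 0%N) = 1.
Proof.
move=> pq lq; rewrite /symP (eq_bigr (fun=> 1)) => [|s _].
  rewrite sumr_const card_Sn -scaler_nat scalerA.
  by rewrite mulVf ?scale1r // factorial_Fp_neq0.
by rewrite act_P big1 // => i _; rewrite big_ord0.
Qed.

Lemma prod_sub_pow_mul_prod (R : comNzRingType) (q l : nat) (y : 'I_l -> R) (t : R)
    (nu : 'I_l -> nat) :
  (\prod_(i < l) \prod_(j < nu i) (y i - t ^+ (q ^ j))) * \prod_(i < l) y i =
  \sum_(I : {set 'I_l})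
     (\prod_(i < l) \prod_(j < nuplus nu I i) (y i - t ^+ (q ^ j))) *
     \prod_(j in ~: I) t ^+ (q ^ nu j).
Proof.
under [X in _ * X = _]eq_bigr => i _ do
  rewrite -(subrK (t ^+ (q ^ nu i)) (y i)).
(* [I] collects the indices where the difference is chosen; it becomes the extra last factor, of
   index [j = nu i]. *)
rewrite bigA_distr mulr_sumr; apply: eq_bigr => I _.
rewrite [X in _ = _ * X]big_mkcond -!big_split /=; apply: eq_bigr => i _.
rewrite in_setC /nuplus; case: (i \in I); rewrite ?mulr1 //.
by rewrite add1n big_ord_recr.
Qed.

Lemma act_P_mul_prod_x (q l : nat) (s : 'S_l) (nu : 'I_l -> nat) :
  Defs.act s (P q nu) * \prod_(i < l) x i =
  \sum_(I : {set 'I_l})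
     Defs.act s (P q (nuplus nu I)) * \prod_(j in ~: I) theta ^+ (q ^ nu j).
Proof.
(* Reordering the product of the variables by [s] matches the factors of [act s (P q nu)], so that
   [y i] is [x (s i)]. *)
rewrite (reindex_inj (@perm_inj _ s)) act_P prod_sub_pow_mul_prod.
by apply: eq_bigr => I _; rewrite act_P.
Qed.

(** Passes from one permutation to the average: [h] is independent of [j], so the two sums can be
    exchanged. *)
Lemma scaler_sum_mul (K : nzRingType) (A : lalgType K) (I J : finType) (c : K)
    (f : J -> A) (g : I -> J -> A) (h : I -> A) (y : A) :
  (forall j, f j * y = \sum_i g i j * h i) ->
  (c *: \sum_j f j) * y = \sum_i (c *: \sum_j g i j) * h i.
Proof.
move=> fE; rewrite -scalerAl mulr_suml (eq_bigr _ (fun j _ => fE j)).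
rewrite exchange_big scaler_sumr; apply: eq_bigr => i _.
by rewrite -scalerAl mulr_suml.
Qed.

Lemma symP_mul_prod_x (q l : nat) (nu : 'I_l -> nat) :
  symP q nu * \prod_(i < l) x i =
  \sum_(I : {set 'I_l})
     symP q (nuplus nu I) * \prod_(j in ~: I) theta ^+ (q ^ nu j).
Proof.
apply: (scaler_sum_mul _ (f := fun s => Defs.act s (P q nu))
  (g := fun I s => Defs.act s (P q (nuplus nu I)))).
by move=> s; apply: act_P_mul_prod_x.
Qed.

Theorem theorem3p3 (q l : nat) (hq : prime q) (hl1 : (1 <= l)%N)
    (hlq : (l <= q - 1)%N) :
  b q l l = 1 /\
  forall nu : 'I_l -> nat,
    b q l (qpow q nu) * \prod_(i < l) x i =
    \sum_(I : {set 'I_l})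
       b q l (qpow q (nuplus nu I)) * \prod_(j in ~: I) theta ^+ (q ^ nu j).
Proof.
have lq : (l < q)%N by rewrite -(prednK (prime_gt0 hq)) ltnS -subn1.
have bE nu : b q l (qpow q nu) = symP q nu by rewrite b_qpow // -subn1.
(* Only the index [l] is rewritten, as a sum of [l] copies of [q ^ 0]; the number of variables
   stays. *)
split=> [|nu]; first by rewrite -[X in b q l X](qpow0 q) bE symP0.
by rewrite bE symP_mul_prod_x; apply: eq_bigr => I _; rewrite bE.
Qed.
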